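(* There exists an absolute constant $C>0$ such that for every $n\in\mathbb N$, every convex body $K\subseteq\mathbb R^n$ with $G_n(K)\neq 0$ and every $1\leq p\leq q$, $$\left(\mathbb E|\langle X, e_n\rangle|^q\right)^{\frac1q}\leq C\,\frac{q}{p}\left(1+\left(\mathbb E|\langle Y,e_n\rangle|^p\right)^{\frac1p}\left(\frac{G_n(K+(-1,1)^n)}{G_n(K)}\right)^{\frac1p}\right),$$ where $X$ is a random vector uniformly distributed on the finite set $K\cap\mathbb Z^n$ and $Y$ is a random vector uniformly distributed on the finite set $(K+(-1,1)^n)\cap\mathbb Z^n$.
   Context: A convex body is a compact convex subset of $\mathbb R^n$ with non-empty interior. $(e_i)_{i=1}^n$ is the canonical basis of $\mathbb R^n$, $\langle\cdot,\cdot\rangle$ is the standard inner product, and $\mathbb E$ denotes expectation. For a bounded set $L\subseteq\mathbb R^n$, $G_n(L)$ is the cardinality of $L\cap\mathbb Z^n$. Sums of sets are Minkowski sums. An absolute constant is a number independent of all parameters ($n$, $K$, $p$, $q$). *)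

(* Defs.v *)
From mathcomp Require Import all_boot all_order all_algebra.
From mathcomp Require Import finmap.
From mathcomp Require Import all_classical all_reals all_analysis.

Set Implicit Arguments.
Unset Strict Implicit.
Unset Printing Implicit Defensive.

Import Order.TTheory GRing.Theory Num.Theory.
Import numFieldNormedType.Exports.

Local Open Scope classical_set_scope.
Local Open Scope ring_scope.

(* R^n is 'rV[R]_n; the statement uses 'rV[R]_n.+1 so that the last
   basis vector e_n exists. *)

Definition inner (R : realType) (n : nat) (u v : 'rV[R]_n) : R :=
  \sum_(i < n) u 0 i * v 0 i.

Definition basis_vec (R : realType) (n : nat) (i : 'I_n) : 'rV[R]_n :=
  delta_mx 0 i.

Definition convex_body (R : realType) (n : nat) (K : set 'rV[R]_n) : Prop :=
  [/\ compact K, convex_set K & interior K !=set0].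

Definition minkowski_sum (R : realType) (n : nat) (A B : set 'rV[R]_n) :
    set 'rV[R]_n :=
  [set x + y | x in A & y in B].

Definition open_cube (R : realType) (n : nat) : set 'rV[R]_n :=
  [set x | forall i, -1 < x 0 i < 1].

Arguments open_cube : clear implicits.

Definition lattice_points (R : realType) (n : nat) (L : set 'rV[R]_n) :
    set 'rV[R]_n :=
  L `&` [set x | forall i, x 0 i \is a Num.int].

(* [fset_set] is the enumeration of a finite set and is empty on infinite
   sets: these counts are meaningful for finite [S] and bounded [L] only. *)
Definition card_set (T : choiceType) (S : set T) : nat := #|` fset_set S|.

Definition lattice_count (R : realType) (n : nat) (L : set 'rV[R]_n) : nat :=
  card_set (lattice_points L).

Definition borel_rV (R : realType) (n : nat) :=
  g_sigma_algebraType (@open 'rV[R]_n).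

Definition uniform_on (R : realType) (n : nat) (d : measure_display)
    (T : measurableType d) (P : probability T R)
    (S : set 'rV[R]_n) (X : {RV P >-> borel_rV R n}) : Prop :=
  forall A : set 'rV[R]_n, measurable (A : set (borel_rV R n)) ->
    distribution P X A = ((card_set (A `&` S))%:R / (card_set S)%:R)%:E.

(* Main.v *)
Require Import Defs.
From mathcomp Require Import all_boot all_order all_algebra.
From mathcomp Require Import zify ring lra.
From mathcomp Require Import all_classical all_reals all_analysis.
From mathcomp Require Import measurable_realfun.

(* A discrete Brunn-Minkowski inequality replaces the continuous one in Borell's
   argument. If A, B are finite sets of lattice points and S contains every
   lattice point of (l A + B) / (l + 1) + (-1, 1)^n, then
   |A|^l |B| <= |S|^(l + 1); this follows by induction on n from a Prekopa-
   Leindler inequality on Z. Write N = G_n(K), let m^p be 1/N times the sum of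
   |y_n|^p over the lattice points y of K + (-1, 1)^n, and put
   u = 2 e^2 (1 + m). Take A = {|x_n| <= u} and B = {|x_n| >= (2 l + 1)(1 + u)}
   among the lattice points of K. Then S lies in K + (-1, 1)^n with |z_n| > u on
   S, so Markov's inequality bounds |S| and, through the complement, |A| from
   below, giving |B| <= N e^(-2 p (l + 1)). Summing this exponential tail over l
   yields the q-th moment. *)

Set Implicit Arguments.
Unset Strict Implicit.
Unset Printing Implicit Defensive.

Import Order.TTheory GRing.Theory Num.Theory.
Import numFieldNormedType.Exports.

Local Open Scope classical_set_scope.
Local Open Scope ring_scope.

(** * Weighted sumset and Prekopa-Leindler inequalities on the integers *)

(* [|z - (l a + b) / (l + 1)| < 1] with the denominator cleared. *)
Definition near_mean (l : nat) (a b z : int) : bool :=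
  `|l.+1%:Z * z - (l%:Z * a + b)| < l.+1%:Z.

Lemma seq_has_min (R : realDomainType) (s : seq R) :
  s != [::] -> exists2 v, v \in s & forall w, w \in s -> v <= w.
Proof.
elim: s => // x s IH _; have [->|s0] := eqVneq s [::].
  by exists x; rewrite ?mem_seq1// => w; rewrite mem_seq1 => /eqP ->.
have [v vs vmin] := IH s0; exists (Num.min x v).
  by rewrite inE; case: leP => _; rewrite ?eqxx// vs orbT.
move=> w; rewrite inE => /predU1P[->|/vmin]; first by rewrite ge_min lexx.
by rewrite ge_min => ->; rewrite orbT.
Qed.

Lemma seq_has_max (R : realDomainType) (s : seq R) :
  s != [::] -> exists2 v, v \in s & forall w, w \in s -> w <= v.
Proof.
move=> s0; have [|v] := @seq_has_min _ [seq - x | x <- s]; first by case: s s0.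
move=> /mapP[x xs ->] xmin; exists x => // w ws.
by rewrite -lerN2; apply/xmin/map_f.
Qed.

(* The cells [l a + j] ([j < l]) translated by [min B] and the points of [B]
   translated past all of them are disjoint; dividing by [l + 1] sends both
   into [S]. *)
Lemma near_mean_size (l : nat) (A B S : seq int) :
  uniq A -> uniq B -> A != [::] -> B != [::] ->
  (forall a b z, a \in A -> b \in B -> near_mean l a b z -> z \in S) ->
  (l * size A + size B <= l.+1 * size S)%N.
Proof.
move=> uA uB A0 B0 AB.
have [am amA amax] := seq_has_max A0.
have [bm bmB bmin] := seq_has_min B0.
pose T1 := [seq l%:Z * a + j%:Z + bm | a <- A, j <- iota 0 l].
pose T2 := [seq l%:Z * (am + 1) + b | b <- B].
pose T := [seq l.+1%:Z * z + i%:Z | z <- S, i <- iota 0 l.+1].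
have -> : (l * size A + size B = size (T1 ++ T2))%N.
  by rewrite size_cat size_allpairs size_map size_iota mulnC.
have -> : (l.+1 * size S = size T)%N.
  by rewrite size_allpairs size_iota mulnC.
apply: uniq_leq_size.
  rewrite cat_uniq; apply/and3P; split.
  - apply: allpairs_uniq => //; first exact: iota_uniq.
    move=> [a j] [a' j'] /allpairsP[[a1 j1] [_ + ->]] /allpairsP[[a2 j2] [_ + ->]].
    rewrite /= !mem_iota => j1l j2l E.
    suff /eqP E1 : a1 == a2 by move: E; rewrite E1 => E; congr (_, _); lia.
    case: (ltgtP a1 a2) => // c; exfalso.
      have : l%:Z * (a1 + 1) <= l%:Z * a2 by apply: ler_wpM2l; lia.
      lia.
    have : l%:Z * (a2 + 1) <= l%:Z * a1 by apply: ler_wpM2l; lia.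
    lia.
  - apply/hasPn => _ /mapP[b bB ->]; apply/negP => /allpairsP[[a j] /= [aA]].
    rewrite mem_iota => jl E.
    have : l%:Z * a <= l%:Z * am by apply: ler_wpM2l => //; exact: amax.
    by have := bmin _ bB; lia.
  - by rewrite map_inj_uniq// => b b' /addrI.
(* [T] consists of the integers whose floor quotient by [l + 1] lies in [S]. The remainder and
   [s - (l a + b)] both lie between [0] and [l], so they differ by less than [l + 1] and the
   quotient of [s] is near the mean. *)
have inT s a b : a \in A -> b \in B -> 0 <= s - (l%:Z * a + b) <= l%:Z -> s \in T.
  move=> aA bB sab.
  apply/allpairsP; exists ((s %/ l.+1%:Z)%Z, `|(s %% l.+1%:Z)%Z|%N) => /=.
  have /= m0 := modz_ge0 s (isT : l.+1%:Z != 0).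
  have /= ml := ltz_pmod s (isT : 0 < l.+1%:Z).
  have E := divz_eq s l.+1%:Z.
  split; last by rewrite gez0_abs// mulrC.
    by apply: AB aA bB _; rewrite /near_mean; move: (s %/ _)%Z (s %% _)%Z E m0 ml; lia.
  by rewrite (mem_iota 0 l.+1); lia.
move=> s; rewrite mem_cat => /orP[/allpairsP[[a j] /= [aA jl ->]]|/mapP[b bB ->]].
  by apply: (inT _ a bm) => //; move: jl; rewrite mem_iota; lia.
by apply: (inT _ am b) => //; lia.
Qed.

(* Layer-cake, peeling off the lowest level of [f] and [g]; the hypothesis on
   [has] says that [f] and [g] have the same maximum. *)
Lemma near_mean_min_sum (R : realDomainType) (l : nat) (f g h : int -> R) (A B S : seq int) :
  uniq A -> uniq B ->
  (forall a, a \in A -> 0 < f a) -> (forall b, b \in B -> 0 < g b) ->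
  (forall z, 0 <= h z) ->
  (forall v, 0 <= v -> has (fun a => v < f a) A = has (fun b => v < g b) B) ->
  (forall a b z, a \in A -> b \in B -> near_mean l a b z ->
     z \in S /\ Num.min (f a) (g b) <= h z) ->
  l%:R * (\sum_(a <- A) f a) + \sum_(b <- B) g b <= l.+1%:R * \sum_(z <- S) h z.
Proof.
have [n] := ubnP (size A + size B)%N.
elim: n => // n IH in f g h A B * => sn uA uB f0 g0 h0 fg H.
have [A0|A0] := eqVneq A [::].
  (* At level [0] the hypothesis on [has] makes [A] and [B] empty together. *)
  have B0 : B = [::].
    case: B {sn uB H IH} g0 fg => // b B g0 /(_ 0 (lexx _)).
    by rewrite A0 /= g0 ?mem_head.
  by rewrite A0 B0 !big_nil mulr0 addr0 mulr_ge0 ?sumr_ge0.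
have B0 : B != [::].
  case: A A0 {sn uA H IH} f0 fg => // a A _ f0 /(_ 0 (lexx _)).
  by rewrite /= f0 ?mem_head//; case: (B).
(* Cutting both functions at their smallest value [v] removes at least one point of [A] or [B], so
   the total size drops. *)
have [v vmem vmin] : exists2 v, v \in map f A ++ map g B &
    forall w, w \in map f A ++ map g B -> v <= w.
  by apply: seq_has_min; case: (A) A0.
have fv a : a \in A -> v <= f a by move=> aA; apply: vmin; rewrite mem_cat map_f.
have gv b : b \in B -> v <= g b.
  by move=> bB; apply: vmin; rewrite mem_cat (map_f g) ?orbT.
have v0 : 0 < v.
  by move: vmem; rewrite mem_cat => /orP[] /mapP[x xA ->]; [exact: f0|exact: g0].
pose A' := [seq a <- A | v < f a]; pose B' := [seq b <- B | v < g b].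
pose P z := has (fun a => has (fun b => near_mean l a b z) B) A.
(* The slab of height [v] is removed from [h] only at points reached from [A] and [B], where [h] is
   known to be at least [v]. *)
pose h' z := if P z then h z - v else h z.
have PP a b z : a \in A -> b \in B -> near_mean l a b z -> P z.
  by move=> aA bB n'; apply/hasP; exists a => //; apply/hasP; exists b.
have hv z : P z -> v <= h z.
  move=> /hasP[a aA /hasP[b bB nab]]; have [_] := H _ _ _ aA bB nab.
  by apply: le_trans; rewrite le_min fv// gv.
have sumc (T : seq int) : v * (size T)%:R = \sum_(a <- T) v.
  by rewrite big_const_seq count_predT iter_addr_0 mulr_natr.
have split_sum (k : int -> R) (T : seq int) : (forall a, a \in T -> v <= k a) ->
    \sum_(a <- T) k a =
    \sum_(a <- [seq a <- T | v < k a]) (k a - v) + v * (size T)%:R.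
  move=> kv; rewrite [in RHS]big_filter [in RHS]big_mkcond/= sumc -big_split/=.
  apply: eq_big_seq => a aT; case: ltP => c; first by rewrite subrK.
  by rewrite add0r; apply/le_anti; rewrite c kv.
have hsum : \sum_(z <- S) h z = \sum_(z <- S) h' z + v * (count P S)%:R.
  rewrite -size_filter sumc big_filter [X in _ = _ + X]big_mkcond -big_split/=.
  by apply: eq_bigr => z _; rewrite /h'; case: (P z); rewrite ?subrK ?addr0.
(* This compares the slabs of height [v]; the induction hypothesis handles what lies above them. *)
have card : (l * size A + size B <= l.+1 * count P S)%N.
  rewrite -size_filter; apply: near_mean_size => // a b z aA bB nab.
  by rewrite mem_filter (PP a b)//; have [] := H _ _ _ aA bB nab.
have {}IH : l%:R * (\sum_(a <- A') (f a - v)) + \sum_(b <- B') (g b - v)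
    <= l.+1%:R * \sum_(z <- S) h' z.
  apply: (IH (fun a => f a - v) (fun b => g b - v)); rewrite ?filter_uniq//.
  - apply: leq_trans (_ : size A + size B <= n)%N; last by [].
    move: vmem; rewrite mem_cat !size_filter => /orP[]/mapP[x xA vE].
      rewrite -addSn leq_add ?count_size// ltn_neqAle count_size andbT.
      rewrite -all_count; apply/allPn; exists x => //.
      by rewrite vE ltxx.
    rewrite -addnS leq_add ?count_size// ltn_neqAle count_size andbT.
    rewrite -all_count; apply/allPn; exists x => //.
    by rewrite vE ltxx.
  - by move=> a; rewrite mem_filter subr_gt0 => /andP[].
  - by move=> a; rewrite mem_filter subr_gt0 => /andP[].
  - by move=> z; rewrite /h'; case: ifP => // /hv; rewrite subr_ge0.
  (* The condition for the cut functions at level [w] is the original one at level [w + v]. *)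
  - move=> w w0; rewrite !has_filter -!filter_predI -!has_filter.
    have E (k : int -> R) : (fun x => (w < k x - v) && (v < k x)) =1 (fun x => w + v < k x).
      by move=> x; apply/idP/idP; lra.
    rewrite (eq_has (E f)) (eq_has (E g)).
    by apply: fg; lra.
  - move=> a b z; rewrite !mem_filter => /andP[_ aA] /andP[_ bB] nab.
    have [zS hz] := H _ _ _ aA bB nab; split => //.
    rewrite /h' (PP a b)// lerBrDr; apply: le_trans hz.
    by rewrite le_min -!lerBrDr !ge_min !lexx orbT.
rewrite (split_sum f A)// (split_sum g B)// hsum.
rewrite -/A' -/B'.
move: card; rewrite -(ler_nat R) natrD !natrM => card.
have := ler_wpM2l (ltW v0) card.
move: IH; set x1 := \sum_(a <- A') _; set x2 := \sum_(b <- B') _.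
set x3 := \sum_(z <- S) _ ; nra.
Qed.

(** AM-GM for [l] copies of [a] and one [b], placed at the last index. *)
Lemma weighted_AGM (R : realFieldType) (l : nat) (a b : R) :
  0 <= a -> 0 <= b -> a ^+ l * b <= ((l%:R * a + b) / l.+1%:R) ^+ l.+1.
Proof.
move=> a0 b0; pose E (i : 'I_l.+1) := if i == ord_max then b else a.
have := @leif_AGM _ _ [set: 'I_l.+1]%SET E.
rewrite cardsT card_ord => -[|+ _].
  by move=> i _; rewrite /E; case: ifP.
rewrite !(eq_bigl predT) => [|i|i]; rewrite ?inE//.
rewrite !big_ord_recr/= /E eqxx.
have nmax (i : 'I_l) : widen_ord (leqnSn l) i == ord_max = false.
  by apply/negbTE; rewrite -val_eqE/= neq_ltn ltn_ord.
under eq_bigr do rewrite nmax; under [in leRHS]eq_bigr do rewrite nmax.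
by rewrite prodr_const sumr_const card_ord mulr_natl.
Qed.

(* One-dimensional Prekopa-Leindler with weights [l / (l + 1)], [1 / (l + 1)]:
   normalise [f] and [g] to have maximum [1], then apply AM-GM. *)
Lemma near_mean_prod_sum (R : realType) (l : nat) (f g h : int -> R) (A B S : seq int) :
  uniq A -> uniq B -> A != [::] -> B != [::] ->
  (forall a, a \in A -> 0 < f a) -> (forall b, b \in B -> 0 < g b) ->
  (forall z, 0 <= h z) ->
  (forall a b z, a \in A -> b \in B -> near_mean l a b z ->
     z \in S /\ f a ^+ l * g b <= h z ^+ l.+1) ->
  (\sum_(a <- A) f a) ^+ l * (\sum_(b <- B) g b) <= (\sum_(z <- S) h z) ^+ l.+1.
Proof.
move=> uA uB A0 B0 f0 g0 h0 H.
have [_ /mapP[am amA ->] fm] : exists2 v, v \in map f A & forall w, w \in map f A -> w <= v.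
  by apply: seq_has_max; case: (A) A0.
have [_ /mapP[bm bmB ->] gm] : exists2 v, v \in map g B & forall w, w \in map g B -> w <= v.
  by apply: seq_has_max; case: (B) B0.
have {fm} fm a : a \in A -> f a <= f am by move=> aA; apply/fm/map_f.
have {gm} gm b : b \in B -> g b <= g bm by move=> bB; apply/gm/map_f.
have F0 := f0 _ amA; have G0 := g0 _ bmB.
set F := f am in fm F0 *; set G := g bm in gm G0 *.
have FG0 : 0 < F ^+ l * G by rewrite mulr_gt0 ?exprn_gt0.
(* Dividing [f], [g], [h] by [F], [G], [c] preserves the multiplicative hypothesis, because
   [c ^+ l.+1 = F ^+ l * G]. *)
pose c := (F ^+ l * G) `^ (l.+1%:R^-1).
have c0 : 0 < c by rewrite powR_gt0.
have cE : c ^+ l.+1 = F ^+ l * G.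
  by rewrite -powR_mulrn ?powR_ge0// -powRrM mulVf ?pnatr_eq0// powRr1// ltW.
have key : l%:R * (\sum_(a <- A) f a / F) + \sum_(b <- B) g b / G <=
    l.+1%:R * \sum_(z <- S) h z / c.
  apply: near_mean_min_sum => //.
  - by move=> a aA; rewrite divr_gt0// f0.
  - by move=> b bB; rewrite divr_gt0// g0.
  - by move=> z; rewrite divr_ge0// ltW.
  - move=> v v0; have [v1|v1] := ltP v 1.
      transitivity true; first by apply/hasP; exists am; rewrite // divff// gt_eqF.
      by apply/esym/hasP; exists bm; rewrite // divff// gt_eqF.
    transitivity false; first apply/negbTE/hasPn => a aA.
      by rewrite -leNgt; apply: le_trans v1; rewrite ler_pdivrMr// mul1r fm.
    apply/esym/negbTE/hasPn => b bB.
    by rewrite -leNgt; apply: le_trans v1; rewrite ler_pdivrMr// mul1r gm.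
  - move=> a b z aA bB nab; have [zS hz] := H _ _ _ aA bB nab; split => //.
    have fa0 := f0 _ aA; have gb0 := g0 _ bB.
    have fF0 : 0 < f a / F by rewrite divr_gt0.
    have gG0 : 0 < g b / G by rewrite divr_gt0.
    have m0 : 0 <= Num.min (f a / F) (g b / G) by rewrite le_min !ltW.
    have hc0 : 0 <= h z / c by rewrite divr_ge0// ltW.
    (* The minimum is at most the weighted geometric mean; comparing powers avoids further roots. *)
    suff : Num.min (f a / F) (g b / G) ^+ l.+1 <= (h z / c) ^+ l.+1.
      by rewrite ler_pXn2r.
    rewrite [leRHS]expr_div_n cE.
    apply: (@le_trans _ _ ((f a / F) ^+ l * (g b / G))).
      rewrite exprSr ler_pM ?exprn_ge0 ?ge_min ?lexx ?orbT//.
      by rewrite lerXn2r ?nnegrE// ?ge_min ?lexx// ltW.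
    rewrite expr_div_n mulf_div ler_pM2r// invr_gt0//.
move: key; rewrite -!mulr_suml.
set sf := \sum_(a <- A) f a; set sg := \sum_(b <- B) g b; set sh := \sum_(z <- S) h z.
move=> key.
have sf0 : 0 <= sf / F.
  by rewrite divr_ge0 ?(ltW F0)// /sf big_seq_cond sumr_ge0// => i /andP[/f0/ltW].
have sg0 : 0 <= sg / G.
  by rewrite divr_ge0 ?(ltW G0)// /sg big_seq_cond sumr_ge0// => i /andP[/g0/ltW].
have sh0 : 0 <= sh / c by rewrite divr_ge0 ?(ltW c0)// /sh sumr_ge0.
have : (sf / F) ^+ l * (sg / G) <= (sh / c) ^+ l.+1.
  apply: le_trans (weighted_AGM l sf0 sg0) _.
  rewrite lerXn2r ?nnegrE//; first by rewrite divr_ge0// addr_ge0// mulr_ge0.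
  by rewrite ler_pdivrMr// [leRHS]mulrC.
by rewrite !expr_div_n cE mulf_div ler_pM2r// invr_gt0.
Qed.

(** * Discrete Brunn-Minkowski inequality by induction on the dimension *)

Definition near_mean_seq (l : nat) (a b z : seq int) :=
  forall i, near_mean l (nth 0 a i) (nth 0 b i) (nth 0 z i).

(** The section over first coordinate [x], with that coordinate dropped. An empty list would count
    as having head [0], which is why membership is characterised only for lists of length [n.+1]. *)
Definition fiber (A : seq (seq int)) (x : int) : seq (seq int) :=
  [seq behead a | a <- A & head 0 a == x].

Lemma size_fiber (A : seq (seq int)) :
  size A = (\sum_(x <- undup (map (head 0%R) A)) size (fiber A x))%N.
Proof.
under eq_bigr do rewrite size_map size_filter -sum1_count.
rewrite (exchange_big_dep predT)//= -sum1_size; apply: eq_big_seq => a aA.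
rewrite (eq_bigl (pred1 (head 0 a))); last by move=> x; rewrite /= eq_sym.
by rewrite -big_filter filter_pred1_uniq ?undup_uniq ?big_seq1// mem_undup map_f.
Qed.

Lemma mem_fiber (A : seq (seq int)) (n : nat) (x : int) (a : seq int) :
  (forall b, b \in A -> size b = n.+1) -> (a \in fiber A x) = (x :: a \in A).
Proof.
move=> sA; apply/mapP/idP => [[b]|xaA].
  rewrite mem_filter => /andP[/eqP bx bA] ->.
  by case: b bx bA (sA b bA) => //= y b -> bA _.
by exists (x :: a) => //; rewrite mem_filter /= eqxx.
Qed.

Lemma fiber_uniq (A : seq (seq int)) (n : nat) (x : int) :
  (forall b, b \in A -> size b = n.+1) -> uniq A -> uniq (fiber A x).
Proof.
move=> sA uA; rewrite map_inj_in_uniq ?filter_uniq// => a b.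
rewrite !mem_filter => /andP[/eqP ax aA] /andP[/eqP bx bA].
by case: a ax aA (sA a aA) => //= y a -> _ _; case: b bx bA (sA b bA) => //= y' b -> _ _ ->.
Qed.

(** The induction hypothesis on sections says that their sizes satisfy the multiplicative hypothesis
    of [near_mean_prod_sum] in the first coordinate; summing section sizes gives the full sizes. The
    counts are cast to [R] because that lemma takes an [(l + 1)]-th root. *)
Lemma discrete_brunn_minkowski (R : realType) (l n : nat) (A B S : seq (seq int)) :
  uniq A -> uniq B -> A != [::] ->
  (forall a, a \in A -> size a = n) -> (forall b, b \in B -> size b = n) ->
  (forall z, z \in S -> size z = n) ->
  (forall a b z, a \in A -> b \in B -> size z = n -> near_mean_seq l a b z -> z \in S) ->
  (size A ^ l * size B <= size S ^ l.+1)%N.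
Proof.
elim: n A B S => [|n IH] A B S uA uB A0 sA sB sS H.
  (* In dimension [0] the empty list is the only point, so all sizes are at most [1]. *)
  have nil1 (T : seq (seq int)) : uniq T -> (forall a, a \in T -> size a = 0%N) -> (size T <= 1)%N.
    move=> uT sT; apply: (@uniq_leq_size _ T [:: [::]] uT) => a /sT/size0nil ->.
    by rewrite mem_seq1.
  case: B uB sB H => [|b B] uB sB H; first by rewrite muln0.
  have S0 : (0 < size S)%N.
    case: A A0 {uA} sA H => // a A _ sA H.
    have : [::] \in S.
      apply: (H a b); rewrite ?mem_head// => i.
      by rewrite (size0nil (sA a (mem_head _ _))) (size0nil (sB b (mem_head _ _))) nth_nil /near_mean; lia.
    by case: (S).
  apply: leq_trans (_ : 1 ^ l * 1 <= _)%N; last by rewrite exp1n expn_gt0 S0.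
  apply: leq_mul; last exact: nil1.
  by case: (l) => // k; rewrite leq_exp2r ?nil1.
have [->|B0] := eqVneq B [::]; first by rewrite muln0.
have heads0 (T : seq (seq int)) : T != [::] -> undup (map (head 0) T) != [::].
  case: T => // a T _; apply/eqP => /(congr1 (fun s => head 0 a \in s)).
  by rewrite mem_undup /= mem_head.
have fib0 (T : seq (seq int)) (x : int) : x \in undup (map (head 0) T) -> fiber T x != [::].
  rewrite mem_undup => /mapP[a aT ->]; rewrite -size_eq0 size_map size_filter.
  by rewrite -lt0n -has_count; apply/hasP; exists a => //=.
rewrite (size_fiber A) (size_fiber B) (size_fiber S).
rewrite -(ler_nat R) natrM !natrX !natr_sum.
apply: near_mean_prod_sum; rewrite ?undup_uniq// ?heads0//.
- by move=> a /fib0; rewrite ltr0n lt0n size_eq0.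
- by move=> a /fib0; rewrite ltr0n lt0n size_eq0.
move=> a b z aA bB nab.
have fS : (size (fiber A a) ^ l * size (fiber B b) <= size (fiber S z) ^ l.+1)%N.
  apply: IH; rewrite ?fib0 ?(fiber_uniq _ sA) ?(fiber_uniq _ sB)//.
  - by move=> x; rewrite (mem_fiber _ _ sA) => /sA[].
  - by move=> x; rewrite (mem_fiber _ _ sB) => /sB[].
  - by move=> x; rewrite (mem_fiber _ _ sS) => /sS[].
  - move=> x y w; rewrite (mem_fiber _ _ sA) (mem_fiber _ _ sB) (mem_fiber _ _ sS).
    by move=> xA yB sw nxy; apply: H xA yB _ _; rewrite /= ?sw// => -[|i]//=; exact: nxy.
split; last by rewrite -!natrX -natrM ler_nat.
(* That [z] is a first coordinate in [S] comes from [fS] itself: its left side is positive, so the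
   section of [S] over [z] is nonempty. *)
rewrite mem_undup; have : fiber S z != [::].
  rewrite -size_eq0 -lt0n; have : (0 < size (fiber S z) ^ l.+1)%N.
    apply: leq_trans fS.
    by rewrite muln_gt0 expn_gt0 !lt0n !size_eq0 !fib0.
  by rewrite expn_gt0 orbF.
case E : (fiber S z) => [//|x s] _.
have : x \in fiber S z by rewrite E mem_head.
by rewrite (mem_fiber _ _ sS) => zxS; apply/mapP; exists (z :: x).
Qed.

(** * From an exponential tail to a moment bound *)

(** Either [x < r], or [x] lies between [(2 i + 1) r] and [(2 i + 3) r] for some [i < n]. In the
    second case [2 i + 3 <= 3 (i + 1)] makes the term of index [i] sufficient, the others being
    nonnegative. *)
Lemma powR_le_annuli (R : realType) (q r x : R) (n : nat) :
  0 < q -> 0 < r -> 0 <= x -> x < n.*2.+1%:R * r ->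
  x `^ q <= r `^ q +
    \sum_(i < n) (i.*2.+1%:R * r <= x)%R%:R * (3 * i.+1%:R * r) `^ q.
Proof.
move=> q0 r0 x0; elim: n => [|n IH] xn.
  by rewrite big_ord0 addr0 ge0_ler_powR ?nnegrE ?(ltW q0) ?(ltW r0)//; move: xn; rewrite mul1r => /ltW.
rewrite big_ord_recr/= addrA; have [c|/IH{}IH] := leP (n.*2.+1%:R * r) x; last first.
  by rewrite mul0r addr0.
rewrite mul1r; apply: le_trans (_ : (3 * n.+1%:R * r) `^ q <= _).
  rewrite ge0_ler_powR ?nnegrE ?(ltW q0) ?mulr_ge0 ?(ltW r0)//.
  apply/ltW/(lt_le_trans xn); rewrite ler_wpM2r ?(ltW r0)// -natrM ler_nat; lia.
rewrite lerDr addr_ge0 ?powR_ge0 ?sumr_ge0// => i _.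
by rewrite mulr_ge0 ?powR_ge0.
Qed.

Lemma expR1_ge2 (R : realType) : 2 <= expR 1 :> R.
Proof. by have := expR_ge1Dx (1 : R); lra. Qed.

(* [expR y >= y] at [y = p k / q] trades the factor [k ^ q] for half of the
   exponential decay. *)
Lemma powR_expR_decay (R : realType) (p q : R) (k : nat) :
  1 <= p -> 0 < q ->
  k%:R `^ q * expR (- (2 * p)) ^+ k <= (q / p) `^ q * 2^-1 ^+ k.
Proof.
move=> p1 q0; have p0 : 0 < p by lra.
have qp0 : 0 <= q / p by rewrite divr_ge0 ?ltW.
have kle : k%:R `^ q <= (q / p) `^ q * expR (p * k%:R).
  have -> : expR (p * k%:R) = expR (p * k%:R / q) `^ q.
    by rewrite -expRM divfK ?gt_eqF.
  rewrite -powRM ?expR_ge0//.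
  rewrite ge0_ler_powR ?nnegrE ?(ltW q0) ?(mulr_ge0 qp0) ?expR_ge0//.
  have := expR_ge1Dx (p * k%:R / q) => e1.
    have {1}-> : k%:R = q / p * (p * k%:R / q) by field; rewrite !gt_eqF.
  by rewrite ler_wpM2l//; lra.
apply: le_trans (ler_wpM2r _ kle) _; first by rewrite exprn_ge0 ?expR_ge0.
rewrite -mulrA ler_wpM2l ?powR_ge0// -expRM_natr -expRD.
have -> : p * k%:R + - (2 * p) * k%:R = (- p) * k%:R by lra.
rewrite expRM_natr; apply: lerXn2r; rewrite ?nnegrE ?expR_ge0//.
(* The surviving half of the decay is [e^(-p k)], at most [2^(-k)] since [p >= 1] and [e >= 2]. *)
rewrite expRN lef_pV2 ?posrE ?expR_gt0//.
by apply: le_trans (expR1_ge2 R) _; rewrite ler_expR.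
Qed.

Lemma sum_half_pow_le1 (R : realFieldType) (n : nat) :
  \sum_(i < n) 2^-1 ^+ i.+1 <= 1 :> R.
Proof.
suff -> : \sum_(i < n) 2^-1 ^+ i.+1 = 1 - 2^-1 ^+ n :> R.
  by have : 0 <= 2^-1 ^+ n :> R; [rewrite exprn_ge0//; lra|lra].
elim: n => [|n IH]; first by rewrite big_ord0 expr0 subrr.
by rewrite big_ord_recr/= IH exprS; lra.
Qed.

(** Sum the annuli bound over [s]: by the tail and [powR_expR_decay], the annulus of index [i]
    contributes at most [2^-(i + 1)] times [(3 (q / p) r)^q] per element, a geometric series. *)
Lemma moment_of_tail (R : realType) (s : seq R) (p q r : R) :
  1 <= p -> p <= q -> 0 < r -> (forall x, x \in s -> 0 <= x) ->
  (forall l : nat, (count (fun x => (l.*2.+1%:R * r <= x)%R) s)%:R <=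
     (size s)%:R * expR (- (2 * p)) ^+ l.+1) ->
  \sum_(x <- s) x `^ q <= (size s)%:R * (6 * (q / p) * r) `^ q.
Proof.
move=> p1 pq r0 s0 tail.
have p0 : 0 < p by lra. have q0 : 0 < q by lra.
have qp1 : 1 <= q / p by rewrite ler_pdivlMr// mul1r.
have qp0 : 0 <= q / p by lra.
(* Each [x / r] is at most the sum of all of them, so one cutoff serves the whole list. *)
have [n sn] : exists n : nat, forall x, x \in s -> x < n.*2.+1%:R * r.
  exists (Num.truncn (\sum_(x <- s) x / r)) => x xs.
  rewrite -ltr_pdivrMr//; apply: le_lt_trans (_ : \sum_(x <- s) x / r < _).
    rewrite (big_rem x)//= lerDl big_seq sumr_ge0// => y /mem_rem/s0 y0.
    by rewrite divr_ge0// ltW.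
  apply: lt_le_trans (truncnS_gt _) _; by rewrite ler_nat ltnS -addnn leq_addr.
apply: le_trans (_ : \sum_(x <- s) (r `^ q +
    \sum_(i < n) (i.*2.+1%:R * r <= x)%R%:R * (3 * i.+1%:R * r) `^ q) <= _).
  by rewrite !big_seq ler_sum// => x xs; rewrite powR_le_annuli ?s0 ?sn.
rewrite big_split/= big_const_seq count_predT iter_addr_0 exchange_big/=.
apply: le_trans (_ : (size s)%:R * (r `^ q * (1 + (3 * (q / p)) `^ q)) <= _).
  rewrite !mulrDr mulr1 mulr_natl lerD2l.
  apply: le_trans (_ : \sum_(i < n) (size s)%:R * (r `^ q * (3 * (q / p)) `^ q) * 2^-1 ^+ i.+1 <= _); last first.
    rewrite -mulr_sumr ler_piMr ?sum_half_pow_le1//.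
    by rewrite !mulr_ge0 ?powR_ge0.
  apply: ler_sum => i _; rewrite -mulr_suml.
  have -> : \sum_(x <- s) (i.*2.+1%:R * r <= x)%R%:R =
      (count (fun x => (i.*2.+1%:R * r <= x)%R) s)%:R :> R.
    by rewrite -sum1_count natr_sum [in RHS]big_mkcond; apply: eq_bigr => x _; case: ifP.
  apply: le_trans (ler_wpM2r (powR_ge0 _ _) (tail i)) _.
  move: (q / p) qp0 (powR_expR_decay i.+1 p1 q0) => y y0; move: (expR _) => E decay.
  rewrite -!mulrA ler_wpM2l// !powRM ?mulr_ge0 ?(ltW r0)//.
  rewrite [leRHS](_ : _ = r `^ q * 3 `^ q * (y `^ q * 2^-1 ^+ i.+1)); last by ring.
  rewrite [leLHS](_ : _ = r `^ q * 3 `^ q * (i.+1%:R `^ q * E ^+ i.+1)); last by ring.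
  by rewrite ler_wpM2l ?mulr_ge0 ?powR_ge0.
rewrite ler_wpM2l//; move: (q / p) qp0 qp1 => y y0 y1.
have -> : 6 * y * r = r * (2 * (3 * y)) by ring.
rewrite [leRHS]powRM ?mulr_ge0 ?(ltW r0)// ler_wpM2l ?powR_ge0//.
rewrite [leRHS]powRM ?mulr_ge0//.
(* With [2 <= 2 ^ q], this absorbs the innermost term: [1 + (3 y)^q <= 2 (3 y)^q <= (6 y)^q]. *)
have y3 : 1 <= (3 * y) `^ q.
  have e1 : 1 `^ q = 1 :> R by rewrite powR1.
  rewrite -[leLHS]e1 ge0_ler_powR ?nnegrE ?(ltW q0)//; lra.
have t2 : 2 <= 2 `^ q :> R.
  rewrite -[leLHS]powRr1// ler_powR//; lra.
by nra.
Qed.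

(** * Lattice points of bounded sets, and their encoding as integer lists *)

(** A form of boundedness that passes from a compact [K] to its sum with the open cube, which is not
    closed. *)
Definition coord_bounded (R : realType) (n : nat) (L : set 'rV[R]_n) :=
  exists b : R, forall x, L x -> forall i, `|x 0 i| <= b.

Lemma lattice_points_finite (R : realType) (n : nat) (L : set 'rV[R]_n) :
  coord_bounded L -> finite_set (lattice_points L).
Proof.
move=> [b Lb]; pose N := Num.truncn b.
pose g (f : {ffun 'I_n -> 'I_N.*2.+1}) : 'rV[R]_n := \row_i ((f i)%:R - N%:R).
apply: (@sub_finite_set _ _ (g @` setT)); last exact: finite_image.
(* Shifting by [N] turns coordinates between [-N] and [N] into ordinals below [2 N + 1]. *)
move=> x [Lx xZ]; exists [ffun i : 'I_n => inord (absz (Num.floor (x 0 i) + N%:Z))] => //.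
apply/rowP => i; rewrite mxE ffunE.
have /intrP[z xz] := xZ i; have := Lb x Lx i; rewrite xz intrKfloor => zb.
have {}zb : (`|z| <= N)%N.
  rewrite -ltnS -(ltr_nat R); apply: le_lt_trans (truncnS_gt b).
  by rewrite natr_absz intr_norm.
rewrite inordK; last by rewrite -addnn; lia.
rewrite !pmulrn -intrB; congr (_%:~R); lia.
Qed.

Lemma convex_body_coord_bounded (R : realType) (n : nat) (K : set 'rV[R]_n.+1) :
  convex_body K -> coord_bounded K.
Proof.
move=> [/compact_bounded[b [breal Kb]] _ _]; exists (b + 1) => x Kx i.
(* Boundedness supplies a bound only for reals strictly above [b], hence [b + 1]. *)
have := Kb (b + 1) ltac:(lra) x Kx; apply: le_trans.
rewrite /Num.norm/= mx_normrE.
exact: (@le_bigmax _ _ _ 0 (fun j => `|x j.1 j.2|) (0, i)).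
Qed.

Lemma minkowski_cube_coord_bounded (R : realType) (n : nat) (K : set 'rV[R]_n) :
  coord_bounded K -> coord_bounded (minkowski_sum K (open_cube R n)).
Proof.
move=> [b Kb]; exists (b + 1) => _ [x Kx [y ycube <-]] i.
rewrite mxE; apply: le_trans (ler_normD _ _) _; apply: lerD (Kb x Kx i) _.
by rewrite ler_norml; have /andP[/ltW-> /ltW->] := ycube i.
Qed.

Definition lattice_seq (R : realType) (n : nat) (L : set 'rV[R]_n) : seq 'rV[R]_n :=
  finmap.enum_fset (fset_set (lattice_points L)).

Lemma size_lattice_seq (R : realType) (n : nat) (L : set 'rV[R]_n) :
  size (lattice_seq L) = lattice_count L.
Proof. by []. Qed.

Lemma lattice_seq_uniq (R : realType) (n : nat) (L : set 'rV[R]_n) :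
  uniq (lattice_seq L).
Proof. exact: finmap.fset_uniq. Qed.

Lemma mem_lattice_seq (R : realType) (n : nat) (L : set 'rV[R]_n) (x : 'rV[R]_n) :
  coord_bounded L -> reflect (lattice_points L x) (x \in lattice_seq L).
Proof.
move=> /lattice_points_finite fL.
have -> : (x \in lattice_seq L) = (x \in lattice_points L) by exact: in_fset_set.
by apply: (iffP idP); rewrite inE.
Qed.

(** Carries lattice vectors to the lists of [discrete_brunn_minkowski]; it is injective on integral
    vectors. *)
Definition floors (R : realType) (n : nat) (x : 'rV[R]_n) : seq int :=
  [seq Num.floor (x 0 i) | i <- enum 'I_n].

Lemma nth_floors (R : realType) (n : nat) (x : 'rV[R]_n) (i : 'I_n) :
  nth 0 (floors x) i = Num.floor (x 0 i).
Proof. by rewrite (nth_map i) ?size_enum_ord// nth_ord_enum. Qed.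

Lemma floors_inj (R : realType) (n : nat) (x y : 'rV[R]_n) :
  (forall i, x 0 i \is a Num.int) -> (forall i, y 0 i \is a Num.int) ->
  floors x = floors y -> x = y.
Proof.
move=> xZ yZ E; apply/rowP => i.
by rewrite -(floorK (xZ i)) -(floorK (yZ i)) -!nth_floors E.
Qed.

Lemma lattice_brunn_minkowski (R : realType) (n l : nat) (A B S : seq 'rV[R]_n) :
  uniq A -> uniq B -> A != [::] ->
  (forall (x : 'rV[R]_n) i, x \in A ++ B ++ S -> x 0 i \is a Num.int) ->
  (forall a b z : 'rV[R]_n, a \in A -> b \in B -> (forall i, z 0 i \is a Num.int) ->
     (forall i, `|l.+1%:R * z 0 i - (l%:R * a 0 i + b 0 i)| < l.+1%:R) ->
     z \in S) ->
  (size A ^ l * size B <= size S ^ l.+1)%N.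
Proof.
move=> uA uB A0 ABSZ H.
have AZ (x : 'rV[R]_n) i : x \in A -> x 0 i \is a Num.int.
  by move=> xA; apply: ABSZ; rewrite mem_cat xA.
have BZ (x : 'rV[R]_n) i : x \in B -> x 0 i \is a Num.int.
  by move=> xA; apply: ABSZ; rewrite !mem_cat xA orbT.
rewrite -(size_map (@floors R n) A) -(size_map (@floors R n) B).
rewrite -(size_map (@floors R n) S).
have sz (T : seq 'rV[R]_n) s : s \in map (@floors R n) T -> size s = n.
  by move=> /mapP[x _ ->]; rewrite size_map size_enum_ord.
apply: (@discrete_brunn_minkowski R l n); try exact: sz.
- by rewrite map_inj_in_uniq// => x y xA yA; apply: floors_inj => i; apply: AZ.
- by rewrite map_inj_in_uniq// => x y xA yA; apply: floors_inj => i; apply: BZ.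
- by case: (A) A0.
move=> _ _ z /mapP[a aA ->] /mapP[b bB ->] sz_z nab.
(* An arbitrary integer list of length [n] is read back as a lattice vector, to which [H]
   applies. *)
have -> : z = floors (\row_(i < n) (nth 0 z i)%:~R : 'rV[R]_n).
  apply: (@eq_from_nth _ 0); first by rewrite size_map size_enum_ord.
  by move=> i; rewrite sz_z => ilt; rewrite (nth_floors _ (Ordinal ilt)) mxE intrKfloor.
apply: map_f; apply: (H a b) => // i; rewrite mxE; first exact: intr_int.
have := nab i; rewrite /near_mean !nth_floors -(ltr_int R) intr_norm.
by rewrite rmorphB rmorphD !rmorphM/= floorK ?AZ// floorK ?BZ.
Qed.

(** * Borel sets and expectations under a uniform law *)

Lemma borel_rV_open (R : realType) (n : nat) (A : set 'rV[R]_n) :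
  open A -> measurable (A : set (borel_rV R n)).
Proof. by move=> oA; exact: sub_sigma_algebra. Qed.

Lemma borel_rV_set1 (R : realType) (n : nat) (x : 'rV[R]_n) :
  measurable ([set x] : set (borel_rV R n)).
Proof.
rewrite -[X in measurable X]setCK; apply: measurableC; apply: borel_rV_open.
by apply: closed_openC; apply: accessible_closed_set1; apply: hausdorff_accessible;
  exact: norm_hausdorff.
Qed.

Lemma borel_rV_finite (R : realType) (n : nat) (S : set 'rV[R]_n) :
  finite_set S -> measurable (S : set (borel_rV R n)).
Proof.
move=> fS; have -> : S = \bigcup_(x in S) [set x] by rewrite bigcup_imset1 image_id.
by apply: fin_bigcup_measurable => // x _; exact: borel_rV_set1.
Qed.

Lemma measurable_coord (R : realType) (n : nat) (i : 'I_n.+1) :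
  measurable_fun setT (fun x : borel_rV R n.+1 => (x : 'rV[R]_n.+1) 0 i).
Proof.
apply: (measurability _ (measurable_realfun.RGenOpens.measurableE R)) => // _ [_ [a [b ->] <-]].
rewrite setTI; apply: borel_rV_open.
have /continuousP := @coord_continuous R 1 n.+1 0 i.
by apply; exact: interval_open.
Qed.

(** Almost surely [X] lies in [S], so [phi (X w)] agrees almost everywhere with a finite combination
    of indicators of the events [X = x], each of probability [1 / card_set S]. *)
Lemma uniform_expectation (R : realType) (n : nat) (d : measure_display)
    (T : measurableType d) (P : probability T R) (S : set 'rV[R]_n)
    (X : {RV P >-> borel_rV R n}) (phi : 'rV[R]_n -> R) :
  finite_set S -> S !=set0 ->
  measurable_fun setT (phi : borel_rV R n -> R) -> (forall x, 0 <= phi x) ->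
  uniform_on S X ->
  ('E_P[fun w => phi (X w)] =
  ((\sum_(x <- finmap.enum_fset (fset_set S)) phi x) / (card_set S)%:R)%:E)%E.
Proof.
move=> fS [x0 Sx0] mphi phi0 uX; set s := finmap.enum_fset _.
have us : uniq s by exact: finmap.fset_uniq.
have sP x : (x \in s) = (x \in S) by exact: in_fset_set.
have X1 x : x \in S -> P (X @^-1` [set x]) = ((card_set S)%:R^-1)%:E.
  rewrite inE => Sx.
  have := uX _ (borel_rV_set1 x).
  rewrite /distribution /pushforward => ->.
  have -> : [set x] `&` S = [set x] by apply/seteqP; split => y /=; [case | move=> ->].
  by rewrite /card_set fset_set1 finmap.cardfs1 div1r.
have mX1 x : measurable (X @^-1` [set x]).
  exact: (measurable_funPTI X (borel_rV_set1 x)).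
have mXS : measurable (X @^-1` S).
  exact: (measurable_funPTI X (borel_rV_finite fS)).
have card0 : (card_set S)%:R != 0 :> R.
  rewrite pnatr_eq0 -lt0n; have : x0 \in s by rewrite sP inE.
  by rewrite /card_set -[X in (0 < X)%N]/(size s); case: (s).
have full : P (~` (X @^-1` S)) = 0%E.
  rewrite probability_setC//; have := uX _ (borel_rV_finite fS).
  by rewrite /distribution /pushforward => ->; rewrite setIid divff// subee.
rewrite unlock.
transitivity (\int[P]_w \sum_(x <- s) ((phi x)%:E * (\1_(X @^-1` [set x]) w)%:E))%E.
  have mind x : measurable_fun setT (fun w : T => ((phi x)%:E * (\1_(X @^-1` [set x]) w)%:E)%E).
    apply: measurable_funeM; apply/measurable_EFinP.
    exact: measurable_indic.
  apply: ge0_ae_eq_integral => //.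
  - by apply/measurable_EFinP; apply: measurableT_comp.
  - exact: emeasurable_sum.
  - by move=> w _; rewrite lee_fin.
  - by move=> w _; apply: sume_ge0 => x _; rewrite -EFinM lee_fin mulr_ge0.
  exists (~` (X @^-1` S)); split => //; first exact: measurableC.
  move=> w nE Sw; apply: nE => _; move: Sw => /= Sw.
  have Xs : X w \in s by rewrite sP inE.
  rewrite (bigD1_seq (X w) Xs us) [in RHS]indicE.
  rewrite mem_set// mule1 big1 => [|x xw]; first by rewrite /= adde0.
  rewrite indicE memNset ?mule0//.
  by move=> /= E; rewrite E eqxx in xw.
rewrite ge0_integral_sum//; last first.
- by move=> x w _; rewrite -EFinM lee_fin mulr_ge0.
- move=> x; apply: measurable_funeM; apply/measurable_EFinP; exact: measurable_indic.
rewrite mulr_suml -sumEFin; apply: eq_big_seq => x xs.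
rewrite ge0_integralZl//.
- by rewrite integral_indic// setIT EFinM; congr (_ * _)%E; apply: X1; rewrite -sP.
- by apply/measurable_EFinP; exact: measurable_indic.
- by rewrite lee_fin.
Qed.

(** * Borell's argument: tail decay and comparison of moments *)

(** As [sigma <= N eps <= N / 2], also [alpha >= N / 2]; dividing the Brunn-Minkowski bound by
    [(N / 2)^l] leaves [beta <= (N / 2) (2 eps)^(l + 1)]. *)
Lemma count_decay (R : realFieldType) (alpha beta sigma N l : nat) (eps E : R) :
  (0 < N)%N -> 0 <= eps -> 2 * eps <= E -> E <= 1 ->
  (N <= alpha + sigma)%N -> sigma%:R <= N%:R * eps ->
  (alpha ^ l * beta <= sigma ^ l.+1)%N ->
  beta%:R <= N%:R * E ^+ l.+1.
Proof.
rewrite -(ltr0n R) => N0 e0 eE E1; rewrite -(ler_nat R) natrD => Nas sN.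
rewrite -(ler_nat R) natrM !natrX => H.
have E0 : 0 <= E by lra.
have aN : N%:R / 2 <= alpha%:R :> R.
  by have : N%:R * eps <= N%:R * (1 / 2); [rewrite ler_pM2l//; lra|lra].
have Ne0 : 0 <= N%:R * eps by rewrite mulr_ge0.
have h : (N%:R / 2) ^+ l * beta%:R <= (N%:R / 2) ^+ l * (N%:R / 2 * (2 * eps) ^+ l.+1).
  apply: le_trans (_ : alpha%:R ^+ l * beta%:R <= _).
    by rewrite ler_wpM2r// lerXn2r ?nnegrE//; lra.
  apply: le_trans H _; rewrite mulrA -exprSr -exprMn lerXn2r ?nnegrE//; lra.
have : beta%:R <= N%:R / 2 * (2 * eps) ^+ l.+1.
  by move: h; rewrite ler_pM2l// exprn_gt0//; lra.
move=> /le_trans; apply; apply: ler_pM; rewrite ?exprn_ge0//; try lra.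
by rewrite lerXn2r ?nnegrE//; lra.
Qed.

(* If [|a_j| <= u] and [|b_j| >= (2 l + 1)(1 + u)] then [(l a + b) / (l + 1)] has
   [j]-th coordinate at least [1 + u] in absolute value, so the lattice points
   within the open cube around it have theirs above [u]. *)
Lemma lattice_tail (R : realType) (n l : nat) (K : set 'rV[R]_n) (j : 'I_n) (u : R) :
  convex_set K -> coord_bounded K ->
  has (fun x : 'rV[R]_n => `|x 0 j| <= u) (lattice_seq K) ->
  (count (fun x : 'rV[R]_n => (`|x 0 j| <= u)%R) (lattice_seq K) ^ l *
   count (fun x : 'rV[R]_n => (l.*2.+1%:R * (1 + u) <= `|x 0 j|)%R) (lattice_seq K) <=
   count (fun x : 'rV[R]_n => (u < `|x 0 j|)%R)
     (lattice_seq (minkowski_sum K (open_cube R n))) ^ l.+1)%N.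
Proof.
move=> cK bK hasA; have bM := minkowski_cube_coord_bounded bK.
have u0 : 0 <= u by have /hasP[x _] := hasA; exact: le_trans.
rewrite -!size_filter; apply: lattice_brunn_minkowski.
- by rewrite filter_uniq ?lattice_seq_uniq.
- by rewrite filter_uniq ?lattice_seq_uniq.
- by rewrite -has_filter.
- move=> x i; rewrite !mem_cat !mem_filter => /or3P[] /andP[_];
  by move=> /mem_lattice_seq -/(_ _)[] // _; apply.
move=> a b z; rewrite !mem_filter => /andP[aj /(mem_lattice_seq _ bK)[Ka aZ]].
move=> /andP[bj /(mem_lattice_seq _ bK)[Kb bZ]] zZ zab.
have l1 : 0 < l.+1%:R :> R by rewrite ltr0n.
have lE : l.+1%:R = l%:R + 1 :> R by rewrite -natr1.
have l0 : 0 <= l%:R :> R by [].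
apply/andP; split.
  have : l.*2.+1%:R * (1 + u) - l%:R * u - l.+1%:R < l.+1%:R * `|z 0 j|.
    have -> : l.+1%:R * `|z 0 j| = `|l.+1%:R * z 0 j| by rewrite normrM ger0_norm.
    have la : l%:R * `|a 0 j| = `|l%:R * a 0 j| by rewrite normrM ger0_norm.
    have : l%:R * `|a 0 j| <= l%:R * u by rewrite ler_wpM2l.
    have := zab j; rewrite la.
    set x1 := l.+1%:R * z 0 j; set x2 := l%:R * a 0 j.
    have t1 := ler_normD (x1 - (x2 + b 0 j)) (- x1).
    have t2 := ler_normD (x2 + b 0 j) (- x2).
    move: t1 t2; rewrite !normrN.
    have -> : x1 - (x2 + b 0 j) - x1 = - (x2 + b 0 j) by ring.
    have -> : x2 + b 0 j - x2 = b 0 j by ring.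
    rewrite normrN; lra.
  have -> : l.*2.+1%:R = 2 * l%:R + 1 :> R by rewrite -natr1 -mul2n natrM.
  rewrite lE => h; rewrite ltNge; apply/negP => zu.
  have : (l%:R + 1) * `|z 0 j| <= (l%:R + 1) * u by rewrite ler_wpM2l//; lra.
  nra.
apply/mem_lattice_seq => //; split => //.
have t0 : 0 <= l%:R / l.+1%:R :> R by rewrite divr_ge0.
have t1 : l%:R / l.+1%:R <= 1 :> R by rewrite ler_pdivrMr// mul1r lE; lra.
(* The weighted mean is in [K] by convexity, and [zab] divided by [l + 1] puts the difference in the
   cube. *)
exists (l%:R / l.+1%:R *: a + (1 - l%:R / l.+1%:R) *: b).
  have := cK a b (Itv01 t0 t1); rewrite !inE => /(_ Ka Kb).
  by [].
exists (z - (l%:R / l.+1%:R *: a + (1 - l%:R / l.+1%:R) *: b)); last by rewrite addrC subrK.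
move=> i; rewrite !mxE.
have := zab i.
have -> : l.+1%:R * z 0 i - (l%:R * a 0 i + b 0 i) =
   (z 0 i - (l%:R / l.+1%:R * a 0 i + (1 - l%:R / l.+1%:R) * b 0 i)) * l.+1%:R.
  by rewrite lE; field; lra.
rewrite normrM (ger0_norm (ltW l1)) -[X in _ < X]mul1r ltr_pM2r//.
by rewrite ltr_norml.
Qed.

Lemma subset_minkowski_cube (R : realType) (n : nat) (K : set 'rV[R]_n) :
  K `<=` minkowski_sum K (open_cube R n).
Proof.
move=> x Kx; exists x => //; exists 0; rewrite ?addr0// => i.
by rewrite mxE; apply/andP; split; lra.
Qed.

(** The probability-free core, in any coordinate: [m] bounds the [p]-th moment over the enlarged
    body, normalised by the count of [K]. *)
Lemma lattice_moment (R : realType) (n : nat) (K : set 'rV[R]_n) (j : 'I_n)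
    (p q m : R) :
  convex_set K -> coord_bounded K -> lattice_count K <> 0%N ->
  1 <= p -> p <= q -> 0 <= m ->
  \sum_(y <- lattice_seq (minkowski_sum K (open_cube R n))) `|y 0 j| `^ p <=
    (lattice_count K)%:R * m `^ p ->
  \sum_(x <- lattice_seq K) `|x 0 j| `^ q <=
    (lattice_count K)%:R *
    (6 * (q / p) * (1 + 2 * expR 2 * (1 + m))) `^ q.
Proof.
move=> cK bK N0 p1 pq m0; rewrite -!size_lattice_seq => Ym.
set c := 2 * expR 2 : R; set u := c * (1 + m).
have bM := minkowski_cube_coord_bounded bK.
have {N0} N0 : (0 < size (lattice_seq K))%N by rewrite lt0n; apply/eqP.
have p0 : 0 < p by lra.
have e0 : 0 < expR 2 :> R := expR_gt0 2.
have c0 : 0 < c by rewrite /c; lra.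
have u0 : 0 < u by rewrite mulr_gt0//; lra.
set L := lattice_seq K in Ym N0 *; set M := lattice_seq _ in Ym.
pose sigma := count (fun y : 'rV[R]_n => (u < `|y 0 j|)%R) M.
pose eps := c^-1 `^ p.
pose E := expR (- (2 * p)) : R.
have E1 : E <= 1 by rewrite -expR0 ler_expR; lra.
(* This fixes [c = 2 e^2]: then [(2 / c)^p = e^(-2 p)], and [2 <= 2^p]. *)
have eE : 2 * eps <= E.
  have : (2 * c^-1) `^ p = E.
    rewrite /c invfM mulrA divff// mul1r -expRN -expRM; congr expR; lra.
  rewrite powRM ?invr_ge0 ?(ltW c0)// => <-; rewrite ler_wpM2r ?powR_ge0//.
  by rewrite -[leLHS]powRr1// ler_powR//; lra.
(* Markov's inequality at height [u], with [m <= 1 + m = u / c]. *)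
have sN : sigma%:R <= (size L)%:R * eps.
  have mu : m `^ p <= u `^ p * eps.
    rewrite -powRM ?invr_ge0 ?(ltW c0) ?(ltW u0)//.
    have -> : u * c^-1 = 1 + m by rewrite /u mulrAC divff ?mul1r// gt_eqF.
    by rewrite ge0_ler_powR ?nnegrE//; lra.
  have up0 : 0 < u `^ p by rewrite powR_gt0.
  rewrite -(ler_pM2r up0); apply: (@le_trans _ _ (\sum_(y <- M) `|y 0 j| `^ p)).
    rewrite /sigma -sum1_count natr_sum mulr_suml big_mkcond/=.
    apply: ler_sum => y _; case: ifP => yu; last exact: powR_ge0.
    by rewrite mul1r ge0_ler_powR ?nnegrE ?(ltW p0) ?(ltW u0)// ltW.
  by apply: le_trans Ym _; rewrite -mulrA ler_wpM2l// mulrC.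
have LM : (count (fun x : 'rV[R]_n => (u < `|x 0 j|)%R) L <= sigma)%N.
  rewrite /sigma -!size_filter; apply: uniq_leq_size.
    by rewrite filter_uniq ?lattice_seq_uniq.
  move=> x; rewrite !mem_filter => /andP[-> /(mem_lattice_seq _ bK)[Kx xZ]].
  by apply/mem_lattice_seq => //; split => //; exact: subset_minkowski_cube.
have Nsplit : (size L <= count (fun x : 'rV[R]_n => (`|x 0 j| <= u)%R) L + sigma)%N.
  rewrite -(count_predC (fun x : 'rV[R]_n => (`|x 0 j| <= u)%R) L) leq_add2l.
  by apply: leq_trans LM; apply: sub_count => x /=; rewrite ltNge.
(* Otherwise [sigma] would be at least [N], while [eps <= 1 / 2] keeps it at most [N / 2]. *)
have hasA : has (fun x : 'rV[R]_n => `|x 0 j| <= u) L.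
  rewrite has_count lt0n; apply/eqP => A0; move: Nsplit; rewrite A0 add0n.
  rewrite -(ler_nat R) => Ns; move: N0; rewrite -(ltr0n R) => N0.
  have : (size L)%:R * eps <= (size L)%:R * (1 / 2) by rewrite ler_pM2l//; lra.
  lra.
have -> : \sum_(x <- L) `|x 0 j| `^ q = \sum_(t <- [seq `|x 0 j| | x : 'rV[R]_n <- L]) t `^ q.
  by rewrite big_map.
rewrite -(size_map (fun x : 'rV[R]_n => `|x 0 j|) L).
apply: moment_of_tail => //; first lra.
  by move=> _ /mapP[x _ ->].
move=> l; rewrite size_map count_map.
apply: (count_decay N0 (powR_ge0 _ _) eE E1 Nsplit sN).
exact: lattice_tail.
Qed.

(** * Passage to random vectors and the final constant *)

Lemma uniform_moment (R : realType) (n : nat) (K : set 'rV[R]_n.+1)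
    (d : measure_display) (T : measurableType d) (P : probability T R)
    (X : {RV P >-> borel_rV R n.+1}) (r : R) :
  coord_bounded K -> lattice_count K <> 0%N -> uniform_on (lattice_points K) X ->
  ('E_P[(fun w => (`|inner (X w) (basis_vec R ord_max)| `^ r)%R)] =
   ((\sum_(x <- lattice_seq K) `|x 0 ord_max| `^ r)%R / (lattice_count K)%:R)%:E)%E.
Proof.
move=> bK K0 uX; have fK := lattice_points_finite bK.
have innerE (x : 'rV[R]_n.+1) : inner x (basis_vec R ord_max) = x 0 ord_max.
  rewrite /inner (bigD1 ord_max)//= /basis_vec mxE !eqxx mulr1 big1 ?addr0// => i io.
  by rewrite mxE (negbTE io) andbF mulr0.
under [X in expectation _ X]eq_fun do rewrite innerE.
apply: (@uniform_expectation R n.+1 d T P (lattice_points K) X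
  (fun x : 'rV[R]_n.+1 => `|x 0 ord_max| `^ r)) => //.
- case E : (lattice_seq K) => [|x s]; first by case: K0; rewrite -size_lattice_seq E.
  by exists x; apply/mem_lattice_seq => //; rewrite E mem_head.
- apply: (measurableT_comp (measurable_powR r)).
  apply: measurableT_comp => //; exact: measurable_coord.
Qed.

Theorem theorem1p1 (R : realType) :
  exists2 C : R, 0 < C &
  forall (n : nat) (K : set 'rV[R]_n.+1) (p q : R),
    convex_body K -> lattice_count K <> 0%N -> 1 <= p -> p <= q ->
  forall (dX : measure_display) (TX : measurableType dX)
    (PX : probability TX R) (X : {RV PX >-> borel_rV R n.+1})
    (dY : measure_display) (TY : measurableType dY)
    (PY : probability TY R) (Y : {RV PY >-> borel_rV R n.+1}),
    uniform_on (lattice_points K) X ->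
    uniform_on (lattice_points (minkowski_sum K (open_cube R n.+1))) Y ->
    ('E_PX[(fun w => (`|inner (X w) (basis_vec R ord_max)| `^ q)%R)] `^ q^-1 <=
     (C * (q / p))%:E *
     (1 + 'E_PY[(fun w => (`|inner (Y w) (basis_vec R ord_max)| `^ p)%R)] `^ p^-1 *
          (((lattice_count (minkowski_sum K (open_cube R n.+1)))%:R /
            (lattice_count K)%:R) `^ p^-1)%:E))%E.
Proof.
have e0 : 0 < expR 2 :> R := expR_gt0 2.
exists (6 * (1 + 2 * expR 2)); first lra.
move=> n K p q cbK N0 p1 pq dX TX PX X dY TY PY Y uX uY.
have bK := convex_body_coord_bounded cbK.
have [_ cK _] := cbK.
have bM := minkowski_cube_coord_bounded bK.
have p0 : 0 < p by lra.
have q0 : 0 < q by lra.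
have NM : (lattice_count K <= lattice_count (minkowski_sum K (open_cube R n.+1)))%N.
  rewrite -!size_lattice_seq; apply: uniq_leq_size; first exact: lattice_seq_uniq.
  move=> x /(mem_lattice_seq _ bK)[Kx xZ]; apply/mem_lattice_seq => //.
  by split => //; exact: subset_minkowski_cube.
have {}N0' : (0 < lattice_count K)%N by rewrite lt0n; apply/eqP.
have M0 := leq_trans N0' NM.
rewrite (uniform_moment _ bK)// (uniform_moment _ bM) //; last by apply/eqP; rewrite -lt0n.
rewrite !poweR_EFin -(EFinM (_ `^ _)) -(EFinD 1) -EFinM lee_fin.
set G := (lattice_count K)%:R; set H := (lattice_count _)%:R.
have G0 : 0 < G :> R by rewrite ltr0n.
have H0 : 0 < H :> R by rewrite ltr0n.
set SY := \sum_(y <- lattice_seq (minkowski_sum _ _)) _.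
have SY0 : 0 <= SY by rewrite sumr_ge0// => y _; exact: powR_ge0.
rewrite -powRM ?divr_ge0 ?ler0n//.
(* The ratio of counts turns the average over the enlarged body into a sum normalised by the count
   of [K], as [lattice_moment] requires. *)
have -> : SY / H * (H / G) = SY / G by field; rewrite !gt_eqF.
set m := (SY / G) `^ p^-1.
have m0 : 0 <= m := powR_ge0 _ _.
have mE : SY <= G * m `^ p.
  rewrite /m -powRrM mulVf ?gt_eqF// powRr1 ?divr_ge0 ?ler0n//.
  by rewrite mulrC divfK// gt_eqF.
have := lattice_moment cK bK N0 p1 pq m0 mE.
set W := 6 * (q / p) * _ => LW.
have qp0 : 0 <= q / p by rewrite divr_ge0 ?ltW.
have W0 : 0 <= W by rewrite /W !mulr_ge0//; nra.
apply: (@le_trans _ _ W).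
  have -> : W = (W `^ q) `^ q^-1 by rewrite -powRrM divff ?powRr1 ?gt_eqF.
  rewrite ge0_ler_powR ?nnegrE ?invr_ge0 ?powR_ge0 ?(ltW q0)//.
    by rewrite divr_ge0// sumr_ge0// => x _; exact: powR_ge0.
  by rewrite ler_pdivrMr// mulrC.
have -> : W = 6 * (q / p) * (1 + 2 * expR 2 * (1 + m)) by [].
(* The constant comes from [1 + 2 e^2 (1 + m) <= (1 + 2 e^2) (1 + m)]. *)
have -> : 6 * (1 + 2 * expR 2) * (q / p) * (1 + m) = 6 * (q / p) * ((1 + 2 * expR 2) * (1 + m)) by ring.
by rewrite ler_wpM2l ?mulr_ge0//; nra.
Qed.
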